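(* Let $M=(E,\mathcal{I})$ be a matroid of rank $r$ and $\mathbf{k}=(k_1,\dots,k_s)$ integers with $0\le k_1<\cdots<k_s\le r$, $s\ge2$. Then every $\mathbf{1}$-cellular string of the rank-selected independence polytope $P_M^{\mathbf{k}}=\mathrm{conv}\{e_I:I\in\mathcal{I},\ |I|\in\{k_1,\dots,k_s\}\}$ is coherent, where $\mathbf{1}(x)=\sum_{e\in E}x_e$.
   Context: $e_I=\sum_{i\in I}e_i$. For a polytope $P$, linear $c$ non-constant on $P$, and face $F$ with $c$ non-constant on $F$, let $F^{\pm c}$ be the faces of $F$ maximizing $\pm c$; $P_{\min}=P^{-c}$, $P_{\max}=P^c$. A $c$-cellular string is a sequence of faces $(F_0,\dots,F_r)$, $c$ non-constant on each, with $F_0^{-c}\subseteq P_{\min}$, $F_r^c\subseteq P_{\max}$, $F_i^c=F_i\cap F_{i+1}=F_{i+1}^{-c}$. For $w$ let $\pi(x)=(\langle c,x\rangle,\langle w,x\rangle)$; the upper boundary of $\pi(P)$ (points $(s,t)$ with $(s,t+\epsilon)\notin\pi(P)$ for all $\epsilon>0$) consists of edges $e_1,\dots,e_r$ left to right, and $(\{x\in P:\pi(x)\in e_i\})_i$ is the coherent cellular string of $w$; a cellular string is coherent if it arises this way for some $w$. *)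

(* Defs.v *)
From HB Require Import structures.
From mathcomp Require Import all_boot all_order all_algebra.
From mathcomp Require Import boolp classical_sets reals.

Set Implicit Arguments.
Unset Strict Implicit.
Unset Printing Implicit Defensive.

Import Order.TTheory GRing.Theory Num.Theory.
Local Open Scope classical_set_scope.
Local Open Scope ring_scope.

(* The regular algebra R^o, convertible to R, provides the lmodType structure
   on functions. *)
Notation "'R^[' R , T ]" := {ffun T -> R^o}
  (at level 0, R at level 99, T at level 99, format "'R^[' R ,  T ]").

Section Polytopes.
Variables (R : realType) (T : finType).
Implicit Types (A P F : set R^[R, T]) (c u x y : R^[R, T]).

Definition dot c x : R := \sum_(e : T) c e * x e.

Definition conv A : set R^[R, T] :=
  [set x | exists (n : nat) (l : 'I_n -> R) (a : 'I_n -> R^[R, T]),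
    [/\ forall i, 0 <= l i, \sum_(i < n) l i = 1, forall i, A (a i)
      & x = \sum_(i < n) l i *: a i]].

(* The intersection of P with a supporting hyperplane; u = 0 gives the
   improper faces P and set0. *)
Definition face P F : Prop :=
  exists (u : R^[R, T]) (b : R),
    (forall x, P x -> dot u x <= b) /\ F = P `&` [set x | dot u x = b].

Definition edge P F : Prop :=
  face P F /\ exists a b : R^[R, T], a <> b /\ F = conv [set a; b].

Definition nonconstant c F : Prop :=
  exists x y, [/\ F x, F y & dot c x <> dot c y].

Definition max_face c F : set R^[R, T] :=
  [set x | F x /\ forall y, F y -> dot c y <= dot c x].

Definition cellular_string c P (Fs : seq (set R^[R, T])) : Prop :=
  let F := nth set0 Fs in
  [/\ (0 < size Fs)%N,
      forall i, (i < size Fs)%N -> face P (F i) /\ nonconstant c (F i),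
      max_face (- c) (F 0%N) `<=` max_face (- c) P,
      max_face c (F (size Fs).-1) `<=` max_face c P
    & forall i, (i.+1 < size Fs)%N ->
        max_face c (F i) = F i `&` F i.+1 /\
        F i `&` F i.+1 = max_face (- c) (F i.+1)].

End Polytopes.

Section Coherence.
Variable R : realType.

Definition point (s t : R) : R^[R, 'I_2] :=
  [ffun i : 'I_2 => if i == ord0 then s else t].

Definition upper_boundary (Q : set R^[R, 'I_2]) : set R^[R, 'I_2] :=
  [set p | exists s t : R,
    [/\ p = point s t, Q (point s t)
      & forall eps : R, 0 < eps -> ~ Q (point s (t + eps))]].

(* No vertical segment lies in the upper boundary, so the left-to-right
   condition also excludes repetitions in es. *)
Definition upper_edges (Q : set R^[R, 'I_2]) (es : seq (set R^[R, 'I_2])) :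
    Prop :=
  (forall e, (exists2 i, (i < size es)%N & e = nth set0 es i) <->
             edge Q e /\ e `<=` upper_boundary Q) /\
  (forall i j, (i < j < size es)%N ->
     forall p q, nth set0 es i p -> nth set0 es j q -> p ord0 <= q ord0).

Variable T : finType.

Definition proj (c w x : R^[R, T]) : R^[R, 'I_2] := point (dot c x) (dot w x).

Definition coherent_string_of (c w : R^[R, T]) (P : set R^[R, T])
    (Fs : seq (set R^[R, T])) : Prop :=
  exists2 es, upper_edges (proj c w @` P) es &
    Fs = [seq P `&` (proj c w @^-1` e) | e <- es].

Definition coherent (c : R^[R, T]) (P : set R^[R, T])
    (Fs : seq (set R^[R, T])) : Prop :=
  exists w : R^[R, T], coherent_string_of c w P Fs.

End Coherence.

Record matroid (E : finType) := Matroid {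
  indep : {set {set E}};
  indep0 : finset.set0 \in indep;
  indep_sub : forall I J : {set E}, J \in indep -> I \subset J -> I \in indep;
  indep_exchange : forall I J : {set E}, I \in indep -> J \in indep ->
    (#|I| < #|J|)%N -> exists2 e, e \in J :\: I & e |: I \in indep }.

Definition rank (E : finType) (M : matroid E) : nat :=
  (\max_(I in indep M) #|I|)%N.

Definition indicator (R : realType) (E : finType) (I : {set E}) : R^[R, E] :=
  [ffun e => (e \in I)%:R].

Definition rank_selected_polytope (R : realType) (E : finType) (M : matroid E)
    (k : seq nat) : set R^[R, E] :=
  conv [set x | exists I : {set E},
    [/\ I \in indep M, #|I| \in k & x = indicator R I]].

Arguments rank_selected_polytope R {E} M k _.

Definition all_ones (R : realType) (E : finType) : R^[R, E] := [ffun=> 1].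

(* Main.v *)
Require Import Defs.
From mathcomp Require Import all_boot all_order all_algebra.
From mathcomp Require Import boolp classical_sets reals.
From mathcomp Require Import zify lra ring.

(* Faces of the polytope correspond to the sets of selected independent sets of
   maximal [u]-weight. Suppose that a weight [w] realizes an initial part of the
   string coherently, its last face having top level [k], and that [u] defines
   the next face. Then [w] and [u] have the same set [G] of optimal independent
   sets of size [k]. By symmetric exchange, every optimal set of another level
   lies inside or contains a member of [G], and elements of the union [V] of [G]
   that can be added to a member of [G] all have the minimal [w]-weight and the
   minimal [u]-weight on [V]. Hence [w] on [V] and a shift of [u] off [V] glue
   to a weight realizing one more face, and induction gives a weight whose
   tilts by decreasing multiples of the height define all faces of the string.
   These tilts are the supporting lines of the upper edges of the projection. *)

Set Implicit Arguments.
Unset Strict Implicit.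
Unset Printing Implicit Defensive.

Import Order.TTheory GRing.Theory Num.Theory.
Local Open Scope ring_scope.

(** * Symmetric exchange and optimal independent sets *)

Section Exchange.
Variables (E : finType) (M : matroid E).
Implicit Types (I J : {set E}) (a b : E).

(** The exchange axiom adds elements of [J] to [I] one at a time until the sizes agree. *)
Lemma indep_extend I J : I \in indep M -> J \in indep M -> (#|I| <= #|J|)%N ->
  exists Z : {set E},
    [/\ Z \in indep M, I \subset Z, Z \subset I :|: J & #|Z| = #|J| ].
Proof.
move=> iI iJ; have [n] := ubnP (#|J| - #|I|); elim: n I iI => // n IHn I iI.
rewrite ltnS => len; rewrite leq_eqVlt => /orP[/eqP eqIJ|ltIJ].
  by exists I; split; rewrite ?finset.subsetUl.
have [e] := indep_exchange iI iJ ltIJ; rewrite inE => /andP[eI eJ] ieI.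
have cU : #|e |: I| = #|I|.+1 by rewrite cardsU1 eI.
have [||Z [iZ sZ Zs cZ]] := IHn _ ieI; rewrite ?cU //; first lia.
exists Z; split => //; first by apply: fintype.subset_trans sZ; exact: finset.subsetUr.
apply: fintype.subset_trans Zs _; apply/fintype.subsetP => x; rewrite !inE.
by case: eqP => [->|]; rewrite ?eJ ?orbT.
Qed.

(** A circuit [C] of [a |: J] passes through [a], and removing any other element [b] of [C] from
    [a |: J] restores independence. It remains to find such a [b] outside [I] that can replace [a]
    in [I]. *)
Lemma indep_exchange_dep I J a : I \in indep M -> J \in indep M ->
    a \in I :\: J -> a |: J \notin indep M ->
  exists2 b, b \in J :\: I &
    b |: (I :\ a) \in indep M /\ a |: (J :\ b) \in indep M.
Proof.
move=> iI iJ; rewrite inE => /andP[aJ aI] daJ.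
have [C /minsetP[dC minC] sC] := minset_exists (P := [pred X | X \notin indep M]) daJ.
have iCD b : b \in C -> C :\ b \in indep M.
  move=> bC; apply/negPn/negP => d.
  have := minC _ d (subD1set _ _) => eqC.
  by have := setD11 b C; rewrite eqC bC.
have aC : a \in C.
  apply/negPn/negP => aC; move: dC; rewrite /= => /negP[].
  apply: indep_sub iJ _; apply/fintype.subsetP => x xC.
  have := fintype.subsetP sC x xC; rewrite !inE => /orP[/eqP eqx|//].
  by rewrite -eqx xC in aC.
have cJa : #|a |: J| = #|J|.+1 by rewrite cardsU1 aJ.
have iJab b : b \in C -> b != a -> a |: (J :\ b) \in indep M.
  move=> bC ba.
  have bJ : b \in J.
    by have := fintype.subsetP sC b bC; rewrite !inE (negbTE ba).
  have sCJ : C :\ b \subset a |: (J :\ b).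
    apply/fintype.subsetP => x; rewrite !inE => /andP[-> xC].
    by have := fintype.subsetP sC x xC; rewrite !inE => /orP[->|->]; rewrite ?orbT.
  (* [Z] extends [C :\ b] inside [C :|: J] and misses [b], since otherwise it would contain [C]. It
     therefore lies in [a |: (J :\ b)], and the sizes agree. *)
  have [|Z [iZ sZ Zs cZ]] := indep_extend (iCD b bC) iJ.
    rewrite (leq_trans (subset_leq_card sCJ)) // cardsU1 inE (negbTE aJ) andbF /=.
    by rewrite (cardsD1 b J) bJ.
  have bZ : b \notin Z.
    apply/negP => bZ; case/negP: dC; apply: indep_sub iZ _.
    by rewrite -(finset.setD1K bC) finset.subUset finset.sub1set bZ.
  suff -> : a |: (J :\ b) = Z by [].
  apply/esym/eqP; rewrite eqEcard; apply/andP; split.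
    apply/fintype.subsetP => x xZ; have := fintype.subsetP Zs x xZ.
    have xb : x != b by apply: contraNneq bZ => <-.
    rewrite !inE xb /= => /orP[xC|->]; last by rewrite orbT.
    by have := fintype.subsetP sC x xC; rewrite !inE.
  rewrite cZ cardsU1 inE (negbTE aJ) andbF /=.
  by rewrite (cardsD1 b J) bJ.
suff [b [bC ba bI iIab]] : exists b,
    [/\ b \in C, b != a, b \notin I & b |: (I :\ a) \in indep M].
  exists b; last by split=> //; apply: iJab.
  have := fintype.subsetP sC b bC; rewrite !inE (negbTE ba) /= => ->.
  by rewrite bI.
have iIa : I :\ a \in indep M by apply: indep_sub iI (subD1set _ _).
have cI : #|I| = #|I :\ a|.+1 by rewrite (cardsD1 a I) aI.
(* The augmenting element comes from [Z] but not from [I :\ a], so it lies in [C :\ a]. *)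
have find Z : Z \in indep M -> (#|I :\ a| < #|Z|)%N ->
    Z \subset (C :\ a) :|: (I :\ a) ->
    exists b, [/\ b \in C, b != a, b \notin I & b |: (I :\ a) \in indep M].
  move=> iZ cZ sZ.
  have [b] := indep_exchange iIa iZ cZ.
  rewrite !inE => /andP[nb bZ] ib.
  have := fintype.subsetP sZ b bZ; rewrite !inE (negbTE nb) orbF => /andP[ba bC].
  by exists b; split=> //; rewrite ba /= in nb.
have [leC|ltC] := leqP #|C :\ a| #|I :\ a|; last first.
  by apply: (find (C :\ a)); rewrite ?iCD ?finset.subsetUl.
(* When [C :\ a] is too small, it is first enlarged to [Y] from [I :\ a] and then by an element [e]
   of [I]. Here [e] is not [a], because [a |: Y] contains [C]. *)
have [Y [iY sY Ys cY]] := indep_extend (iCD a aC) iIa leC.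
have ltYI : (#|Y| < #|I|)%N by rewrite cY cI.
have [e] := indep_exchange iY iI ltYI; rewrite inE => /andP[eY eI] ieY.
have [eqea|nea] := eqVneq e a.
  case/negP: dC; apply: indep_sub ieY _; rewrite eqea -(finset.setD1K aC).
  exact: finset.setUS.
apply: (find (e |: Y)) => //; first by rewrite cardsU1 eY cY.
by rewrite finset.subUset Ys finset.sub1set !inE nea eI orbT.
Qed.

(** If [a |: J] is independent, any [b] of [J] that augments [I :\ a] will do, and such a [b] exists
    because [#|I :\ a| < #|J|]. Otherwise the dependent case applies. *)
Lemma indep_sym_exchange I J a : I \in indep M -> J \in indep M ->
    (#|I| <= #|J|)%N -> a \in I :\: J ->
  exists2 b, b \in J :\: I &
    b |: (I :\ a) \in indep M /\ a |: (J :\ b) \in indep M.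
Proof.
move=> iI iJ leIJ aIJ.
have [iaJ|] := boolP (a |: J \in indep M); last exact: indep_exchange_dep.
move: aIJ; rewrite inE => /andP[aJ aI].
have iIa : I :\ a \in indep M by apply: indep_sub iI (subD1set _ _).
have [|b] := indep_exchange iIa iJ.
  by move: leIJ; rewrite (cardsD1 a I) aI.
rewrite !inE => /andP[nb bJ] ib.
have nba : b != a by apply: contraNneq aJ => <-.
exists b; first by rewrite !inE bJ; rewrite nba /= in nb; rewrite nb.
by split=> //; apply: indep_sub iaJ _; apply: finset.setUS; apply: subD1set.
Qed.

End Exchange.

(** * Maximizers on a finite set *)

Section Argmax.
Variables (R : realDomainType) (X : finType).
Implicit Types (S Z : {set X}) (f g : X -> R).

Definition argmax S f : {set X} :=
  [set x in S | [forall y in S, f y <= f x]]%SET.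

Lemma argmaxP S f x :
  reflect (x \in S /\ forall y, y \in S -> f y <= f x) (x \in argmax S f).
Proof.
rewrite inE; apply: (iffP andP) => -[xS H]; split=> //; first exact/forall_inP.
exact/forall_inP.
Qed.

Lemma argmax_sub S f x : x \in argmax S f -> x \in S.
Proof. by case/argmaxP. Qed.

Lemma argmax_neq0 S f x : x \in S -> exists y, y \in argmax S f.
Proof.
move=> xS; have [y yS H] := arg_maxP f xS.
by exists y; apply/argmaxP; split.
Qed.

Lemma argmax_eqval S f x y : x \in argmax S f -> y \in argmax S f -> f x = f y.
Proof.
by move=> /argmaxP[xS hx] /argmaxP[yS hy]; apply: le_anti; rewrite hy ?hx.
Qed.

Lemma argmax_mem S f x y : x \in argmax S f -> y \in S -> f x <= f y ->
  y \in argmax S f.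
Proof.
move=> /argmaxP[xS hx] yS le_xy; apply/argmaxP; split=> // z zS.
exact: le_trans (hx z zS) le_xy.
Qed.

Lemma argmax_ext S f g (C : R) : (forall x, x \in S -> f x = g x + C) ->
  argmax S f = argmax S g.
Proof.
move=> fg; apply/finset.setP => x; apply/argmaxP/argmaxP => -[xS hx]; split=> // y yS.
  by have := hx y yS; rewrite !fg // lerD2r.
by rewrite !fg // lerD2r hx.
Qed.

(** A maximizer of [f] and one of [g] both lie in [Z], where the two functions differ by a constant,
    so each also maximizes the other function. *)
Lemma argmax_agree S Z f g (C : R) :
    (forall x, x \in argmax S f -> x \in Z) ->
    (forall x, x \in argmax S g -> x \in Z) ->
    (forall x, x \in Z -> f x = g x + C) ->
  argmax S f = argmax S g.
Proof.
move=> fZ gZ fg; apply/finset.setP => x; apply/idP/idP => hx.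
  have [y hy] := argmax_neq0 g (argmax_sub hx).
  apply: (argmax_mem hy); first exact: argmax_sub hx.
  have /argmaxP[_ /(_ y (argmax_sub hy))] := hx.
  by rewrite !fg ?lerD2r; auto.
have [y hy] := argmax_neq0 f (argmax_sub hx).
apply: (argmax_mem hy); first exact: argmax_sub hx.
have /argmaxP[_ /(_ y (argmax_sub hy))] := hx.
by rewrite !fg ?lerD2r; auto.
Qed.

Lemma argmax_restrict S Z f x : Z \subset S -> x \in Z ->
    (forall y, y \in S -> y \notin Z -> f y < f x) ->
  argmax S f = argmax Z f.
Proof.
move=> /fintype.subsetP ZS xZ out; apply/finset.setP => y.
apply/argmaxP/argmaxP => -[yS hy].
  split; last by move=> z /ZS; exact: hy.
  by apply/negPn/negP => /(out y yS); rewrite ltNge hy ?ZS.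
split=> [|z zS]; first exact: ZS.
have [/hy//|/(out z zS)/ltW le_zx] := boolP (z \in Z).
exact: le_trans le_zx (hy x xZ).
Qed.

End Argmax.

(** * Optimal independent sets of a given size *)

Section OptimalSets.
Variables (R : realDomainType) (E : finType) (M : matroid E).
Implicit Types (I J : {set E}) (a b e : E) (w u : E -> R).

Definition weight w I : R := \sum_(e in I) w e.

Definition level k : {set {set E}} := [set I in indep M | #|I| == k]%SET.

Definition opt k w := argmax (level k) (weight w).

Lemma weightU1 w e I : e \notin I -> weight w (e |: I) = w e + weight w I.
Proof. by move=> eI; rewrite /weight big_setU1. Qed.

Lemma weightD1 w e I : e \in I -> weight w I = w e + weight w (I :\ e).
Proof. by move=> eI; rewrite /weight (big_setD1 e). Qed.

Lemma weight_swap w a b I : a \in I -> b \notin I ->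
  weight w (b |: (I :\ a)) = weight w I + (w b - w a).
Proof.
move=> aI bI; rewrite weightU1 ?inE ?(negbTE bI) ?andbF // (weightD1 w aI).
ring.
Qed.

Lemma weight_subset w I J : I \subset J ->
  weight w J = weight w I + \sum_(e in J :\: I) w e.
Proof.
move=> IJ; rewrite /weight (big_setID I) /=.
by rewrite (_ : J :&: I = I)%SET //; apply/finset.setIidPr.
Qed.

Lemma card_swap a b I : a \in I -> b \notin I -> #|b |: (I :\ a)| = #|I|.
Proof.
by move=> aI bI; rewrite cardsU1 !inE (negbTE bI) andbF /= [RHS](cardsD1 a) aI.
Qed.

Lemma levelP k I : reflect (I \in indep M /\ #|I| = k) (I \in level k).
Proof. by rewrite inE; apply: (iffP andP) => -[-> /eqP]. Qed.

Lemma opt_level k w I : I \in opt k w -> I \in indep M /\ #|I| = k.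
Proof. by move/argmax_sub/levelP. Qed.

(** A symmetric exchange can raise neither weight, which gives both inequalities between [w a] and
    [w b]. Equality keeps the two exchanged sets optimal. *)
Lemma opt_swap k k' w I J a : (k <= k')%N -> I \in opt k w -> J \in opt k' w ->
    a \in I :\: J ->
  exists2 b, b \in J :\: I &
    [/\ w b = w a, b |: (I :\ a) \in opt k w & a |: (J :\ b) \in opt k' w].
Proof.
move=> lek oI oJ aIJ.
have [iI cI] := opt_level oI; have [iJ cJ] := opt_level oJ.
have [|b bJI [iIab iJba]] := indep_sym_exchange iI iJ _ aIJ; first by rewrite cI cJ.
move: (aIJ) (bJI); rewrite !inE => /andP[aJ aI] /andP[bI bJ].
have lI : b |: (I :\ a) \in level k by apply/levelP; rewrite card_swap.
have lJ : a |: (J :\ b) \in level k' by apply/levelP; rewrite card_swap.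
have /argmaxP[_ /(_ _ lI)] := oI; have /argmaxP[_ /(_ _ lJ)] := oJ.
rewrite !weight_swap // !gerDl !subr_le0 => le_ab le_ba.
have eqw : w b = w a by apply: le_anti; rewrite le_ba.
exists b => //; split=> //.
  by apply: argmax_mem oI lI _; rewrite weight_swap // eqw subrr addr0.
by apply: argmax_mem oJ lJ _; rewrite weight_swap // eqw subrr addr0.
Qed.

(** Swapping an element of [I :\: J] into [J] keeps [J] optimal, and the element given up is outside
    [I], so [I :\: J] shrinks. *)
Lemma opt_extend k k' w I J : (k <= k')%N -> I \in opt k w -> J \in opt k' w ->
  exists2 J', J' \in opt k' w & I \subset J'.
Proof.
move=> lek oI; have [n] := ubnP #|I :\: J|; elim: n J => // n IHn J ltn oJ.
have [IJ|/fintype.subsetPn[a aI aJ]] := boolP (I \subset J); first by exists J.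
have aIJ : a \in I :\: J by rewrite inE aI aJ.
have [b bJI [_ _ oJ']] := opt_swap lek oI oJ aIJ.
apply: IHn oJ'; move: ltn; rewrite (cardsD1 a) aIJ ltnS; apply: leq_trans.
rewrite add1n ltnS; apply/subset_leq_card/fintype.subsetP => x.
rewrite !inE negb_or !negb_and negbK => /andP[/andP[-> /orP[/eqP xb|->//]]].
by move: bJI; rewrite xb inE => /andP[/negbTE->].
Qed.

(** The same swaps, now performed in [I], replace elements of [I :\: J] by elements of [J] until [I]
    lies inside [J]. *)
Lemma opt_shrink k k' w I J : (k <= k')%N -> I \in opt k w -> J \in opt k' w ->
  exists2 I', I' \in opt k w & I' \subset J.
Proof.
move=> lek + oJ; have [n] := ubnP #|I :\: J|; elim: n I => // n IHn I ltn oI.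
have [IJ|/fintype.subsetPn[a aI aJ]] := boolP (I \subset J); first by exists I.
have aIJ : a \in I :\: J by rewrite inE aI aJ.
have [b bJI [_ oI' _]] := opt_swap lek oI oJ aIJ.
apply: IHn oI'; move: ltn; rewrite (cardsD1 a) aIJ ltnS; apply: leq_trans.
rewrite add1n ltnS; apply/subset_leq_card/fintype.subsetP => x.
move: bJI; rewrite !inE => /andP[_ bJ] /andP[xJ /orP[/eqP xb|/andP[-> ->]]].
  by rewrite xb bJ in xJ.
by rewrite xJ.
Qed.

(** Swapping [a] out of [J] brings in an element of [I] of the same weight. In particular every set
    in [opt k w] contains an element of least weight on the union of them all. *)
Lemma opt_min k w I J a : I \in opt k w -> J \in opt k w -> a \in J ->
  exists2 b, b \in I & w b = w a.
Proof.
move=> oI oJ aJ; have [aI|aI] := boolP (a \in I); first by exists a.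
have [|b] := opt_swap (leqnn k) oJ oI (a := a); first by rewrite inE aI.
by rewrite inE => /andP[_ bI] [eqw _ _]; exists b.
Qed.

(** [J] contains an element [a] of the minimal weight [t]. Replacing it by [e] cannot raise the
    weight, so [w e <= t], and equality makes the new set optimal and puts [e] in the union. *)
Lemma opt_addable k w t J e : J \in opt k w ->
    (forall x, x \in finset.cover (opt k w) -> t <= w x) ->
    (exists2 x, x \in finset.cover (opt k w) & w x = t) ->
    e \notin J -> e |: J \in indep M ->
  w e <= t /\ (w e == t) = (e \in finset.cover (opt k w)).
Proof.
move=> oJ mint [x /finset.bigcupP[J' oJ' xJ'] wx] eJ ieJ.
have [a aJ wa] := opt_min oJ oJ' xJ'; rewrite wx in wa.
have [_ cJ] := opt_level oJ.
have lJ : e |: (J :\ a) \in level k.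
  apply/levelP; rewrite card_swap //; split=> //.
  by apply: indep_sub ieJ _; apply: finset.setUS; apply: subD1set.
have le_et : w e <= t.
  by have /argmaxP[_ /(_ _ lJ)] := oJ; rewrite weight_swap // wa gerDl subr_le0.
split=> //; apply/eqP/idP => [wet|/mint le_te]; last by apply: le_anti; rewrite le_et.
apply/finset.bigcupP; exists (e |: (J :\ a)); last by rewrite !inE eqxx.
by apply: argmax_mem oJ lJ _; rewrite weight_swap // wa wet subrr addr0.
Qed.

(** For [w'], elements off the union are lighter than all elements on it. A set optimal for [w'] is
    therefore reached from one optimal for [w] by exchanges within the union that keep
    optimality. *)
Lemma opt_modify k w w' t : 
    (forall x, x \in finset.cover (opt k w) -> t <= w x) ->
    (forall x, x \in finset.cover (opt k w) -> w' x = w x) ->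
    (forall x, x \notin finset.cover (opt k w) -> w' x < t) ->
  opt k w' = opt k w.
Proof.
move=> mint eqw ltw.
have sub J1 J : J1 \in opt k w' -> J \in opt k w -> J1 \in opt k w.
  move=> oJ1; have [n] := ubnP #|J1 :\: J|; elim: n J => // n IHn J ltn oJ.
  have [iJ cJ] := opt_level oJ; have [iJ1 cJ1] := opt_level oJ1.
  have [J1J|/fintype.subsetPn[a aJ1 aJ]] := boolP (J1 \subset J).
    suff -> : J1 = J by [].
    by apply/eqP; rewrite eqEcard J1J cJ cJ1 /=.
  have aD : a \in J1 :\: J by rewrite inE aJ1 aJ.
  have [|b bD [iJ1ab iJba]] := indep_sym_exchange iJ1 iJ _ aD; first by rewrite cJ cJ1.
  move: (bD); rewrite inE => /andP[bJ1 bJ].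
  have lJ1 : b |: (J1 :\ a) \in level k by apply/levelP; rewrite card_swap.
  have lJ : a |: (J :\ b) \in level k by apply/levelP; rewrite card_swap.
  have /argmaxP[_ /(_ _ lJ1)] := oJ1; have /argmaxP[_ /(_ _ lJ)] := oJ.
  rewrite !weight_swap // !gerDl !subr_le0 => le_ab le_ba.
  have bV : b \in finset.cover (opt k w) by apply/finset.bigcupP; exists J.
  (* Optimality of [J1] for [w'] gives [w' a >= w' b >= t], which excludes [a] outside the union. *)
  have aV : a \in finset.cover (opt k w).
    apply/negPn/negP => /ltw; apply/negP; rewrite -leNgt.
    by apply: le_trans le_ba; rewrite (eqw _ bV) mint.
  apply: (IHn (a |: (J :\ b))).
    move: ltn; rewrite (cardsD1 a) aD ltnS; apply: leq_trans.
    rewrite add1n ltnS; apply/subset_leq_card/fintype.subsetP => x.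
    rewrite !inE negb_or !negb_and negbK => /andP[/andP[-> /orP[/eqP xb|->//]]].
    by rewrite xb (negbTE bJ1).
  apply: argmax_mem oJ lJ _; rewrite weight_swap //.
  by rewrite lerDl subr_ge0 -(eqw _ aV) -(eqw _ bV).
have [J0 oJ0|no] := pickP [pred J | J \in opt k w].
  apply: (@argmax_agree _ _ _ (opt k w) _ _ 0) => [J oJ|//|J oJ].
    exact: sub oJ oJ0.
  rewrite addr0; apply: eq_bigr => x xJ; apply: eqw; apply/finset.bigcupP; by exists J.
apply/finset.setP => J; rewrite [RHS]no; apply/negP => oJ.
have [J0 oJ0] := argmax_neq0 (weight w) (argmax_sub oJ).
by have := no J0; rewrite /= oJ0.
Qed.

End OptimalSets.

(** * Gluing weights *)

Section Glue.
Variables (R : realDomainType) (E : finType) (M : matroid E) (K : seq nat).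
Implicit Types (I J : {set E}) (a b e : E) (w u : E -> R) (S : {set {set E}}).

Definition selected : {set {set E}} := [set I in indep M | #|I| \in K]%SET.

(** When sets are plotted by size and weight, this is the height above the line of slope [th]
    through the origin, so its maximizers lie on a supporting line of slope [th]. *)
Definition tilt w (th : R) I : R := weight w I - th * #|I|%:R.

Lemma selectedP I : reflect (I \in indep M /\ #|I| \in K) (I \in selected).
Proof. by rewrite inE; apply: andP. Qed.

Lemma tilt0 w I : tilt w 0 I = weight w I.
Proof. by rewrite /tilt mul0r subr0. Qed.

Lemma tiltE w th I : tilt w th I = weight (fun e => w e - th) I.
Proof. by rewrite /tilt /weight sumrB sumr_const mulr_natr. Qed.

Lemma tilt_lt_up w (a b : R) I J : tilt w a I <= tilt w a J -> a < b ->
  (#|J| < #|I|)%N -> tilt w b I < tilt w b J.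
Proof.
rewrite -(ltr_nat R) -subr_gt0 -[a < b]subr_gt0 /tilt => le_a lt_ab lt_JI.
have := mulr_gt0 lt_ab lt_JI; move: le_a; clear; lra.
Qed.

Lemma tilt_lt_down w (a b : R) I J : tilt w a I <= tilt w a J -> b < a ->
  (#|I| < #|J|)%N -> tilt w b I < tilt w b J.
Proof.
rewrite -(ltr_nat R) -subr_gt0 -[b < a]subr_gt0 /tilt => le_a lt_ab lt_JI.
have := mulr_gt0 lt_ab lt_JI; move: le_a; clear; lra.
Qed.

(** Among sets of one size the tilt differs from the weight by a constant. *)
Lemma argmax_opt S w th I : I \in argmax S (tilt w th) -> I \in indep M ->
  (forall J, J \in level M #|I| -> J \in S) -> I \in opt M #|I| w.
Proof.
move=> /argmaxP[_ hI] iI sub; apply/argmaxP; split; first exact/levelP.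
move=> J lJ; have := hI J (sub J lJ); have /levelP[_ cJ] := lJ.
by rewrite /tilt cJ lerD2r.
Qed.

(** A maximizer of a tilt among these sets is optimal at its own level, hence extends to an optimal
    set of size [k] and lies inside the union, where [u] and [w] agree. *)
Lemma argmax_le_level k w u J0 :
    (forall x, x \in finset.cover (opt M k w) -> u x = w x) ->
    J0 \in opt M k w -> opt M k u = opt M k w ->
    let S := [set I in selected | (#|I| <= k)%N]%SET in
  forall th, argmax S (tilt u th) = argmax S (tilt w th).
Proof.
move=> eqw oJ0 eqo S' th; rewrite {}/S'; set S' := [set I in _ | _]%SET.
have cov v : opt M k v = opt M k w -> forall I, I \in argmax S' (tilt v th) ->
    I \in powerset (finset.cover (opt M k w)).
  move=> ev I hI; have := argmax_sub hI; rewrite inE => /andP[/selectedP[iI cI] leI].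
  have oI : I \in opt M #|I| v.
    apply: (argmax_opt hI iI) => J /levelP[iJ cJ].
    by rewrite !inE iJ cJ cI.
  have oJ0v : J0 \in opt M k v by rewrite ev.
  have [J oJ IJ] := opt_extend leI oI oJ0v.
  rewrite inE; apply: (fintype.subset_trans IJ); apply: (finset.bigcup_sup J) => //.
  by rewrite -ev.
apply: (@argmax_agree _ _ _ _ _ _ 0) (cov u eqo) (cov w erefl) _ => I.
rewrite inE => /fintype.subsetP sI; rewrite addr0 /tilt; congr (_ - _).
by apply: eq_bigr => x /sI /eqw.
Qed.

(* [w] defines the face below level [#|J0|] and [u] the face above it; [d] is the
   drop of slope of the upper boundary at that level. *)
Lemma glue w u J0 I0 I1 :
    J0 \in argmax selected (weight w) -> J0 \in argmax selected (weight u) ->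
    (forall I, I \in argmax selected (weight w) -> (#|I| <= #|J0|)%N) ->
    (forall I, I \in argmax selected (weight u) -> (#|J0| <= #|I|)%N) ->
    (forall I, #|I| = #|J0| ->
      (I \in argmax selected (weight w)) = (I \in argmax selected (weight u))) ->
    I0 \in argmax selected (weight w) -> (#|I0| < #|J0|)%N ->
    I1 \in argmax selected (weight u) -> (#|J0| < #|I1|)%N ->
  exists (w' : E -> R) (d : R),
    [/\ 0 < d, forall th, 0 <= th ->
        argmax selected (tilt w' th) = argmax selected (tilt w th)
      & argmax selected (tilt w' (- d)) = argmax selected (weight u)].
Proof.
move=> wJ0 uJ0 wle ule wu wI0 ltI0 uI1 ltI1; set k := #|J0| in wle ule wu ltI0 ltI1 *.
have [iJ0 cJ0] := selectedP _ (argmax_sub wJ0).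
have selk I : I \in level M k -> I \in selected.
  by move=> /levelP[iI cI]; apply/selectedP; rewrite cI.
(* [J0] has size [k] and maximal weight among all selected sets, so the sets optimal in level [k]
   are exactly the global maximizers of that size. *)
have argk (v : E -> R) : J0 \in argmax selected (weight v) -> forall I,
    (I \in opt M k v) = (I \in argmax selected (weight v)) && (#|I| == k).
  move=> vJ0 I; apply/idP/andP => [oI|[vI /eqP cI]].
    have [iI cI] := opt_level oI; split; last exact/eqP.
    apply: (argmax_mem vJ0); first by apply/selk/levelP.
    by have /argmaxP[_ ->] := oI => //; apply/levelP.
  rewrite -cI; apply: (@argmax_opt selected v 0); rewrite ?cI //.
    by rewrite (argmax_ext (g := weight v) (C := 0)) // => x _; rewrite tilt0 addr0.
  by have /selectedP[] := argmax_sub vI.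
have eqo : opt M k u = opt M k w.
  apply/finset.setP => I; rewrite !argk //; case: eqP => [cI|]; rewrite ?andbF //.
  by rewrite wu.
have oJ0 : J0 \in opt M k w by rewrite argk // wJ0 /=.
set V := finset.cover (opt M k w).
have subV J : J \in opt M k w -> {subset J <= V}.
  by move=> oJ x xJ; apply/finset.bigcupP; exists J.
have [x0 x0V] : exists x, x \in V.
  have /card_gt0P[x xJ0] : (0 < #|J0|)%N by exact: leq_ltn_trans ltI0.
  by exists x; exact: subV oJ0 _ xJ0.
have [xw xwV minw] := arg_minP w x0V; have [xu xuV minu] := arg_minP u x0V.
set t := w xw in minw; set m := u xu in minu.
have adw J e : J \in opt M k w -> e \notin J -> e |: J \in indep M ->
    w e <= t /\ (w e == t) = (e \in V).
  by move=> oJ; apply: opt_addable oJ minw _; exists xw.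
have adu J e : J \in opt M k w -> e \notin J -> e |: J \in indep M ->
    u e <= m /\ (u e == m) = (e \in V).
  rewrite /V -eqo => oJ; apply: opt_addable oJ _ _; rewrite eqo //.
  by exists xu.
(* An element off [V] with [u e >= m] lies in the span of every set in
   [opt M k w], so its new weight only has to be less than [t]. *)
pose w' e := if e \in V then w e else if u e < m then t + (u e - m) else t - 1.
have w'V e : e \in V -> w' e = w e by rewrite /w' => ->.
have w'nV e : e \notin V -> w' e < t.
  rewrite /w' => /negbTE->; case: ifP => [lt_um|_]; last by rewrite gtrBl.
  by rewrite gtrDl subr_lt0.
have eqo' : opt M k w' = opt M k w by exact: opt_modify minw w'V w'nV.
have low th : argmax _ (tilt w' th) = argmax _ (tilt w th) :=
  argmax_le_level w'V oJ0 eqo' th.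
have uJ J : J \in opt M k w -> weight u J = weight u J0.
  by move: oJ0; rewrite -eqo => oJ0u oJ; apply: argmax_eqval oJ oJ0u.
have wJ J : J \in opt M k w -> weight w J = weight w J0.
  by move=> oJ; apply: argmax_eqval oJ oJ0.
have addI J I e : J \subset I -> I \in indep M -> e \in I :\: J ->
    e \notin J /\ e |: J \in indep M.
  rewrite inE => JI iI /andP[eJ eI]; split=> //.
  by apply: indep_sub iI _; rewrite finset.subUset finset.sub1set eI.
pose hi := [set I in selected | (k <= #|I|)%N]%SET.
have hiJ0 : J0 \in hi by rewrite inE (argmax_sub wJ0) leqnn.
have hiopt v th I : I \in argmax hi (tilt v th) -> opt M k v = opt M k w ->
    I \in indep M /\ exists2 J, J \in opt M k w & J \subset I.
  move=> hI ev; have := argmax_sub hI; rewrite inE => /andP[/selectedP[iI cI] leI].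
  split=> //.
  have oI : I \in opt M #|I| v.
    by apply: (argmax_opt hI iI) => J /levelP[iJ cJ]; rewrite !inE iJ cJ cI.
  have oJ0v : J0 \in opt M k v by rewrite ev.
  by have := opt_shrink leI oJ0v oI; rewrite ev.
have sub0 v I : tilt v 0 I = weight v I + 0 by rewrite tilt0 addr0.
have hiu : argmax selected (weight u) = argmax hi (weight u).
  apply: (argmax_restrict (x := J0)) => // [|I sI nhi].
    by apply/fintype.subsetP => I; rewrite inE => /andP[].
  rewrite ltNge; apply/negP => leu; have := ule _ (argmax_mem uJ0 sI leu).
  by move: nhi; rewrite inE sI /= => /negP.
(* The two faces force [t <= 0 <= m]: enlarging [I0] to size [k] adds elements of total [w]-weight
   0, each at least [t], while [I1] exceeds a member of [opt M k w] by elements of total [u]-weight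
   0, each at most [m]. *)
have d_gt0 : 0 < m - t.
  have I1hi : I1 \in argmax hi (tilt u 0).
    by rewrite (argmax_ext (fun x _ => sub0 u x)) -hiu.
  have [iI1 [J oJ JI1]] := hiopt _ _ _ I1hi eqo.
  have su0 : \sum_(e in I1 :\: J) u e = 0.
    have := weight_subset u JI1; rewrite (argmax_eqval uI1 uJ0) uJ //.
    by move/eqP; rewrite -subr_eq0 opprD addNKr oppr_eq0 => /eqP.
  have sw0 : weight w I0 = weight w J0 by exact: argmax_eqval wI0 wJ0.
  have [|I0' oI0' I0I0'] := opt_extend (ltnW ltI0) _ oJ0 (I := I0).
    apply: (@argmax_opt selected w 0).
    - by rewrite (argmax_ext (fun x _ => sub0 w x)).
    - by have /selectedP[] := argmax_sub wI0.
    have /selectedP[_ cI0] := argmax_sub wI0.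
    by move=> J' /levelP[iJ' cJ']; apply/selectedP; rewrite cJ'.
  have sw0' : \sum_(e in I0' :\: I0) w e = 0.
    have := weight_subset w I0I0'; rewrite wJ // sw0 => /eqP.
    by rewrite -subr_eq0 opprD addNKr oppr_eq0 => /eqP.
  have t_le0 : t <= 0.
    have : \sum_(e in I0' :\: I0) t <= 0.
      rewrite -[leRHS]sw0'; apply: ler_sum => e; rewrite inE => /andP[_ eI0'].
      by apply: minw; apply: subV oI0' _ eI0'.
    by rewrite sumr_const pmulrn_lle0 // cardsDS // subn_gt0 (opt_level oI0').2.
  have m_ge0 : 0 <= m.
    have : 0 <= \sum_(e in I1 :\: J) m.
      rewrite -[leLHS]su0; apply: ler_sum => e eIJ.
      by have [eJ ieJ] := addI J I1 e JI1 iI1 eIJ; have [] := adu J e oJ eJ ieJ.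
    by rewrite sumr_const pmulrn_lge0 // cardsDS // subn_gt0 (opt_level oJ).2.
  (* If [m <= t], both vanish. Elements of [I1 :\: J] then have [u]-weight 0, hence lie in [V] and
     have [w]-weight 0, so [I1] would maximize [w] above level [k]. *)
  rewrite subr_gt0 ltNge; apply/negP => le_mt.
  have t0 : t = 0 by apply: le_anti; rewrite t_le0 (le_trans m_ge0 le_mt).
  have m0 : m = 0 by apply: le_anti; rewrite m_ge0 andbT -t0.
  suff : I1 \in argmax selected (weight w) by move/wle; rewrite leqNgt ltI1.
  apply: (argmax_mem wJ0); first exact: argmax_sub uI1.
  rewrite (weight_subset w JI1) wJ // big1 ?addr0 // => e eIJ.
  have [eJ ieJ] := addI J I1 e JI1 iI1 eIJ.
  have [_ eq_um] := adu J e oJ eJ ieJ; have [_ eq_wt] := adw J e oJ eJ ieJ.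
  apply/eqP; rewrite -t0 eq_wt -eq_um m0 -oppr_eq0; apply/eqP.
  apply: (psumr_eq0P (P := [in I1 :\: J]) (F := fun e => - u e)) eIJ.
    move=> a aIJ; rewrite oppr_ge0 -m0.
    by have [aJ iaJ] := addI J I1 a JI1 iI1 aIJ; have [] := adu J a oJ aJ iaJ.
  by rewrite sumrN su0 oppr0.
(* Adding [m - t] turns [w'] into [u] on every element that can be added to a member of [opt M k w]:
   on [V] the two values are [t] and [m], and off [V] this is how [w'] was chosen. Every maximizer
   in [hi] contains such a member. *)
have highE : argmax hi (tilt w' (- (m - t))) = argmax hi (weight u).
  rewrite -(argmax_ext (fun x _ => sub0 u x)).
  apply: (@argmax_agree _ _ _ [set I in indep M | [exists J in opt M k w, J \subset I]]%SET
     _ _ (weight (fun e => w' e - - (m - t)) J0 - weight u J0)).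
  - move=> I /hiopt -/(_ eqo')[iI [J oJ JI]]; rewrite inE iI.
    by apply/exists_inP; exists J.
  - move=> I /hiopt -/(_ eqo)[iI [J oJ JI]]; rewrite inE iI.
    by apply/exists_inP; exists J.
  move=> I; rewrite inE => /andP[iI /exists_inP[J oJ JI]].
  rewrite tilt0 tiltE (weight_subset _ JI) (weight_subset u JI) uJ //.
  have -> : weight (fun e => w' e - - (m - t)) J = weight (fun e => w' e - - (m - t)) J0.
    rewrite -!tiltE /tilt (opt_level oJ).2 -/k; congr (_ - _).
    by move: oJ oJ0; rewrite -eqo'; apply: argmax_eqval.
  have -> : \sum_(e in I :\: J) (w' e - - (m - t)) = \sum_(e in I :\: J) u e.
    apply: eq_bigr => e eIJ; have [eJ ieJ] := addI J I e JI iI eIJ.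
    have [le_wt eq_wt] := adw J e oJ eJ ieJ; have [le_um eq_um] := adu J e oJ eJ ieJ.
    rewrite /w'; case: ifP => eV; last first.
      rewrite lt_neqAle eq_um eV le_um /=; ring.
    move: eq_wt eq_um; rewrite eV => /eqP-> /eqP->; ring.
  ring.
exists w', (m - t); split=> //.
- move=> th th0; pose lo := [set I in selected | (#|I| <= k)%N]%SET.
  have loS : lo \subset selected by apply/fintype.subsetP => I; rewrite inE => /andP[].
  have loJ0 : J0 \in lo by rewrite inE (argmax_sub wJ0) leqnn.
  (* At slope [- (m - t)] a set above level [k] does not beat [J0], so at any slope [th >= 0] it
     loses strictly, being larger. *)
  rewrite (argmax_restrict (x := J0) loS loJ0) => [|I sI nlo]; last first.
    have ltk : (k < #|I|)%N by move: nlo; rewrite inE sI /= -ltnNge.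
    have hI : I \in hi by rewrite inE sI ltnW.
    have /argmaxP[_ /(_ _ hI)] : J0 \in argmax hi (tilt w' (- (m - t))).
      by rewrite highE -hiu.
    by move=> /tilt_lt_up; apply=> //; apply: lt_le_trans th0; rewrite oppr_lt0.
  rewrite (argmax_restrict (x := J0) loS loJ0) => [|I sI nlo]; last first.
    have ltk : (k < #|I|)%N by move: nlo; rewrite inE sI /= -ltnNge.
    have lt_w : weight w I < weight w J0.
      rewrite ltNge; apply/negP => lew; have := wle _ (argmax_mem wJ0 sI lew).
      by rewrite leqNgt ltk.
    by rewrite /tilt ltr_leD // lerN2 ler_wpM2l // ler_nat ltnW.
  exact: low.
rewrite hiu -highE.
have hiS : hi \subset selected by apply/fintype.subsetP => I; rewrite inE => /andP[].
rewrite (argmax_restrict (x := J0) hiS hiJ0) // => I sI nhi.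
have ltk : (#|I| < k)%N by move: nhi; rewrite inE sI /= -ltnNge.
(* A set below level [k] does not beat [J0] at slope 0, so it loses strictly at the negative
   slope. *)
apply: (tilt_lt_down (a := 0)); rewrite ?oppr_lt0 //.
have : J0 \in argmax [set I in selected | (#|I| <= k)%N]%SET (tilt w' 0).
  rewrite low (argmax_ext (fun x _ => sub0 w x)); apply/argmaxP; split.
    by rewrite inE (argmax_sub wJ0) leqnn.
  by have /argmaxP[_ hw] := wJ0; move=> J'; rewrite inE => /andP[/hw].
by case/argmaxP => _; apply; rewrite inE sI ltnW.
Qed.

End Glue.

(** * Assembling a whole chain of faces *)

Section Chain.
Variables (R : realDomainType) (E : finType) (M : matroid E) (K : seq nat).
Implicit Types I : {set E}.

Lemma tilt_shift (w : E -> R) (a b : R) I :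
  tilt (fun e => w e - a) b I = tilt w (a + b) I.
Proof.
by rewrite !tiltE; apply: eq_bigr => e _; rewrite opprD addrA.
Qed.

(** Induction on the number of faces, gluing one further face at the upper end. Recording that
    [lam n] is the least slope gives all earlier faces a nonnegative slope relative to the last one,
    as gluing requires. *)
Lemma argmax_chain n (u : nat -> E -> R) (lo hi : nat -> nat) :
    let V j := argmax (selected M K) (weight (u j)) in
    (forall j, (j <= n)%N -> [/\ (lo j < hi j)%N,
       forall I, I \in V j -> (lo j <= #|I| <= hi j)%N,
       exists2 I, I \in V j & #|I| = lo j
     & exists2 I, I \in V j & #|I| = hi j]) ->
    (forall j, (j < n)%N -> hi j = lo j.+1 /\
       forall I, #|I| = hi j -> (I \in V j) = (I \in V j.+1)) ->
  exists (w : E -> R) (lam : nat -> R),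
    (forall j, (j <= n)%N -> lam n <= lam j) /\
    (forall j, (j <= n)%N -> argmax (selected M K) (tilt w (lam j)) = V j).
Proof.
move=> V; elim: n => [|n IHn] bnd link.
  exists (u 0%N), (fun=> 0); split=> // j; rewrite leqn0 => /eqP->.
  by apply: argmax_ext => I _; rewrite tilt0 -[LHS]addr0.
have [j jn|j jn|w [lam [lam_le lamE]]] := IHn; first by apply: bnd; rewrite ltnW.
  by apply: link; rewrite ltnW.
(* The last face is brought to slope 0, where the gluing takes place. *)
pose w0 e := w e - lam n.
have w0E th : argmax (selected M K) (tilt w0 th) =
    argmax (selected M K) (tilt w (lam n + th)).
  by apply: (argmax_ext (C := 0)) => I _; rewrite addr0 tilt_shift.
have w0V : argmax (selected M K) (weight w0) = V n.
  rewrite -(lamE n (leqnn n)) -[lam n in RHS]addr0 -w0E.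
  by apply: (argmax_ext (C := 0)) => I _; rewrite tilt0 addr0.
have [ltn1 bndn [In In_V cIn] [J J_V cJ]] := bnd n (leqnSn n).
have [ltS bndS [JS JS_V cJS] [IS IS_V cIS]] := bnd n.+1 (leqnn _).
have [hilo VV] := link n (ltnSn n).
have [|||||||||w' [d [d_gt0 low high]]] := @glue R E M K w0 (u n.+1) J In IS.
- by rewrite w0V.
- by rewrite -VV.
- by move=> I; rewrite w0V cJ => /bndn /andP[].
- by move=> I /bndS /andP[]; rewrite cJ hilo.
- by move=> I cI; rewrite w0V VV // cI cJ.
- by rewrite w0V.
- by rewrite cIn cJ.
- by [].
- by rewrite cJ hilo cIS.
(* The shift is undone, so the earlier slopes are unchanged and the new face gets slope
   [lam n - d]. *)
exists (fun e => w' e + lam n), (fun j => if (j <= n)%N then lam j else lam n - d).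
have w''E th : argmax (selected M K) (tilt (fun e => w' e + lam n) th) =
    argmax (selected M K) (tilt w' (th - lam n)).
  apply: (argmax_ext (C := 0)) => I _; rewrite addr0 addrC -tilt_shift !tiltE.
  by apply: eq_bigr => e _; rewrite opprK.
split=> j /=; rewrite ?ltnn.
  by move=> _; case: ifP => [jn|_//]; apply: le_trans (lam_le j jn); rewrite gerBl ltW.
rewrite w''E; case: ifP => [jn _|jn jn1].
  by rewrite low ?subr_ge0 ?lam_le // w0E addrC subrK lamE.
have -> : j = n.+1 by apply/eqP; rewrite eqn_leq jn1 ltnNge jn.
by rewrite addrAC subrr add0r high.
Qed.

End Chain.

(** * Convex hulls and planar upper boundaries *)

Local Open Scope classical_set_scope.

Section Convexity.
Variables (R : realType) (T : finType).
Implicit Types (A C P : set R^[R, T]) (c u v x y a b : R^[R, T]).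

Lemma dotDr u x y : dot u (x + y) = dot u x + dot u y.
Proof. by rewrite -big_split; apply: eq_bigr => e _; rewrite ffunE mulrDr. Qed.

Lemma dotZr u (t : R) x : dot u (t *: x) = t * dot u x.
Proof. by rewrite mulr_sumr; apply: eq_bigr => e _; rewrite ffunE mulrCA. Qed.

Lemma dot_sumr u n (f : 'I_n -> R^[R, T]) :
  dot u (\sum_(i < n) f i) = \sum_(i < n) dot u (f i).
Proof.
rewrite /dot exchange_big /=; apply: eq_bigr => e _.
by rewrite sum_ffunE mulr_sumr.
Qed.

Lemma dotNl u x : dot (- u) x = - dot u x.
Proof. by rewrite -sumrN; apply: eq_bigr => e _; rewrite ffunE mulNr. Qed.

Lemma dotDl u v x : dot (u + v) x = dot u x + dot v x.
Proof. by rewrite -big_split; apply: eq_bigr => e _; rewrite ffunE mulrDl. Qed.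

Lemma dotZl u (t : R) x : dot (t *: u) x = t * dot u x.
Proof. by rewrite mulr_sumr; apply: eq_bigr => e _; rewrite ffunE mulrA. Qed.

Lemma dot_conv u n (l : 'I_n -> R) (f : 'I_n -> R^[R, T]) :
  dot u (\sum_(i < n) l i *: f i) = \sum_(i < n) l i * dot u (f i).
Proof. by rewrite dot_sumr; apply: eq_bigr => i _; rewrite dotZr. Qed.

Definition convex C := forall x y (t : R),
  C x -> C y -> 0 <= t -> t <= 1 -> C ((1 - t) *: x + t *: y).

Lemma conv_mem A x : A x -> conv A x.
Proof.
move=> Ax; exists 1%N, (fun=> 1), (fun=> x); split=> //; rewrite ?big_ord1 //.
by rewrite scale1r.
Qed.

Lemma conv_convex A : convex (conv A).
Proof.
move=> _ _ t [n [l [f [l0 l1 fA ->]]]] [m [k [g [k0 k1 gA ->]]]] t0 t1.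
exists (n + m)%N,
  (fun i => match split i with inl i => (1 - t) * l i | inr i => t * k i end),
  (fun i => match split i with inl i => f i | inr i => g i end).
have sl (i : 'I_n) : split (lshift m i) = inl i by exact: (unsplitK (inl i)).
have sr (i : 'I_m) : split (rshift n i) = inr i by exact: (unsplitK (inr i)).
split.
- by move=> i; case: split => j; rewrite mulr_ge0 // subr_ge0.
- rewrite big_split_ord /=; under eq_bigr do rewrite sl.
  under [X in _ + X = _]eq_bigr do rewrite sr.
  by rewrite -!mulr_sumr l1 k1 !mulr1 subrK.
- by move=> i; case: split.
rewrite big_split_ord /= !scaler_sumr; congr (_ + _).
  by apply: eq_bigr => i _; rewrite sl scalerA.
by apply: eq_bigr => i _; rewrite sr scalerA.
Qed.

Lemma convex_hyperplane C u (b : R) : convex C -> convex (C `&` [set x | dot u x = b]).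
Proof.
move=> cC x y t [Cx ux] [Cy uy] t0 t1; split; first exact: cC.
by rewrite /= dotDr !dotZr ux uy -mulrDl subrK mul1r.
Qed.

Lemma conv2_mem a b (t : R) : 0 <= t -> t <= 1 ->
  conv [set a; b] ((1 - t) *: a + t *: b).
Proof. by apply: conv_convex; apply: conv_mem; [left|right]. Qed.

(** The coefficients of the points equal to [b] are collected into one, and the remaining ones
    belong to [a]. *)
Lemma conv2_sub C a b : convex C -> C a -> C b -> conv [set a; b] `<=` C.
Proof.
move=> cC Ca Cb _ [n [l [f [l0 l1 fab ->]]]].
have -> : \sum_(i < n) l i *: f i =
    (1 - \sum_(i < n | f i == b) l i) *: a + (\sum_(i < n | f i == b) l i) *: b.
  rewrite -l1 (bigID (fun i => f i == b)) /= [in RHS](bigID (fun i => f i == b) xpredT) /=.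
  rewrite addrAC subrr add0r !scaler_suml addrC; congr (_ + _); apply: eq_bigr => i.
    by case: (fab i) => [->//|/= ->]; rewrite eqxx.
  by move=> /eqP->.
apply: cC => //; first exact: sumr_ge0.
by rewrite -l1 [leRHS](bigID (fun i => f i == b)) /= lerDl sumr_ge0.
Qed.

Lemma conv_le A u (b : R) x : (forall a, A a -> dot u a <= b) -> conv A x ->
  dot u x <= b.
Proof.
move=> ub [n [l [f [l0 l1 fA ->]]]]; rewrite dot_conv -[b]mul1r -l1 mulr_suml.
by apply: ler_sum => i _; rewrite ler_wpM2l // ub.
Qed.

(** The terms [l i * (b - dot u (f i))] are nonnegative and sum to 0, so a point with nonzero
    coefficient attains the bound. *)
Lemma conv_support A u (b : R) x : (forall a, A a -> dot u a <= b) ->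
    conv A x -> dot u x = b ->
  exists (n : nat) (l : 'I_n -> R) (f : 'I_n -> R^[R, T]),
    [/\ forall i, 0 <= l i, \sum_(i < n) l i = 1, forall i, A (f i)
      & x = \sum_(i < n) l i *: f i] /\ forall i, l i != 0 -> dot u (f i) = b.
Proof.
move=> ub [n [l [f [l0 l1 fA xE]]]] uxb; exists n, l, f; split=> // i li.
have s0 : \sum_(i < n) l i * (b - dot u (f i)) = 0.
  under eq_bigr do rewrite mulrBr.
  by rewrite sumrB -mulr_suml l1 mul1r -dot_conv -xE uxb subrr.
have ge0 j : true -> 0 <= l j * (b - dot u (f j)).
  by move=> _; rewrite mulr_ge0 // subr_ge0 ub.
have /eqP := psumr_eq0P ge0 s0 (i := i) isT.
by rewrite mulf_eq0 (negbTE li) subr_eq0 => /eqP.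
Qed.

(** Only generators attaining [b] contribute to [x], so an equation on a face need only be checked
    at its generators. *)
Lemma conv_face_dot A u v (b b' : R) x : (forall a, A a -> dot u a <= b) ->
    (forall a, A a -> dot u a = b -> dot v a = b') ->
  conv A x -> dot u x = b -> dot v x = b'.
Proof.
move=> ub uv Ax uxb.
have [n [l [f [[l0 l1 fA ->] sup]]]] := conv_support ub Ax uxb.
rewrite dot_conv -[RHS]mul1r -l1 mulr_suml; apply: eq_bigr => i _.
have [->|li] := eqVneq (l i) 0; first by rewrite !mul0r.
by rewrite (uv (f i)) // sup.
Qed.

(** If every contributing generator had a smaller value of [c], so would their average [x]. *)
Lemma conv_face_extreme A u c (b : R) x : (forall a, A a -> dot u a <= b) ->
    conv A x -> dot u x = b ->
  exists a, [/\ A a, dot u a = b & dot c x <= dot c a].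
Proof.
move=> ub Ax uxb.
have [n [l [f [[l0 l1 fA xE] sup]]]] := conv_support ub Ax uxb.
have [i /andP[li le_xi]|no] := pickP (fun i => (l i != 0) && (dot c x <= dot c (f i))).
  by exists (f i); split=> //; exact: sup.
have s0 : \sum_(i < n) l i * (dot c x - dot c (f i)) = 0.
  under eq_bigr do rewrite mulrBr.
  by rewrite sumrB -mulr_suml l1 mul1r -dot_conv -xE subrr.
have lt_fx i : l i != 0 -> dot c (f i) < dot c x.
  by move=> li; have := no i; rewrite li /= => /negbT; rewrite -ltNge.
have ge0 i : true -> 0 <= l i * (dot c x - dot c (f i)).
  move=> _; have [->|/lt_fx/ltW] := eqVneq (l i) 0; first by rewrite mul0r.
  by rewrite -subr_ge0; apply: mulr_ge0.
suff : \sum_(i < n) l i = 0 by rewrite l1 => /eqP; rewrite oner_eq0.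
apply: big1 => i _; apply/eqP/negPn/negP => li.
have /eqP := psumr_eq0P ge0 s0 (i := i) isT.
by rewrite mulf_eq0 (negbTE li) /= subr_eq0 gt_eqF ?lt_fx.
Qed.

End Convexity.

(** * Upper boundary of a planar convex set *)

Section Planar.
Variable R : realType.
Implicit Types (p q a b v : R^[R, 'I_2]) (Q : set R^[R, 'I_2]).

Lemma dot2 v p : dot v p = v ord0 * p ord0 + v ord_max * p ord_max.
Proof.
by rewrite /dot big_ord_recl big_ord1; congr (_ + v _ * p _); apply: val_inj.
Qed.

Lemma midpoint_strict (s t x y : R) : x != y -> s <= x <= t -> s <= y <= t ->
  s < (1 - 2^-1) * x + 2^-1 * y /\ (1 - 2^-1) * x + 2^-1 * y < t.
Proof. by rewrite neq_lt => /orP[] h /andP[h1 h2] /andP[h3 h4]; split; lra. Qed.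

Lemma midpoint_max (m x y : R) : x <= m -> y <= m ->
  (1 - 2^-1) * x + 2^-1 * y = m -> m <= x /\ m <= y.
Proof. by move=> h1 h2 h3; split; lra. Qed.

Lemma planar_ext p q : p ord0 = q ord0 -> p ord_max = q ord_max -> p = q.
Proof.
move=> h0 h1; apply/ffunP => i; have [->//|->//] : i = ord0 \/ i = ord_max.
by case: i => [[|[|//]] hi]; [left|right]; apply: val_inj.
Qed.

Lemma point0 (s t : R) : Defs.point s t ord0 = s. Proof. by rewrite ffunE. Qed.

Lemma point1 (s t : R) : Defs.point s t ord_max = t. Proof. by rewrite ffunE. Qed.

Lemma pointE p : p = Defs.point (p ord0) (p ord_max).
Proof. by apply: planar_ext; rewrite ?point0 ?point1. Qed.

Lemma combE a b (t : R) i : ((1 - t) *: a + t *: b) i = (1 - t) * a i + t * b i.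
Proof. by rewrite !ffunE. Qed.

Lemma dot_line (l : R) p : dot (Defs.point (- l) 1) p = p ord_max - l * p ord0.
Proof. by rewrite dot2 point0 point1 mul1r mulNr addrC. Qed.

Variables (Q : set R^[R, 'I_2]) (n : nat) (lam c lo hi : nat -> R).
Variables (A B : nat -> R^[R, 'I_2]).

(** The vector with entries [- lam j] and 1 is normal to the line of slope [lam j], and [c j] is the
    intercept. The hypotheses below make these parts of [Q] consecutive segments with ends [A j] and
    [B j], spanning the whole width of [Q]. *)
Definition support_line j := Q `&` [set p | dot (Defs.point (- lam j) 1) p = c j].

Hypothesis convQ : convex Q.
Hypothesis below : forall j p, (j <= n)%N -> Q p -> dot (Defs.point (- lam j) 1) p <= c j.
Hypothesis lo_lt_hi : forall j, (j <= n)%N -> lo j < hi j.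
Hypothesis hi_lo : forall j, (j < n)%N -> hi j = lo j.+1.
Hypothesis rangeQ : forall p, Q p -> lo 0%N <= p ord0 <= hi n.
Hypothesis rangeL : forall j p, (j <= n)%N -> support_line j p -> lo j <= p ord0 <= hi j.
Hypothesis endA : forall j, (j <= n)%N -> support_line j (A j) /\ A j ord0 = lo j.
Hypothesis endB : forall j, (j <= n)%N -> support_line j (B j) /\ B j ord0 = hi j.

Lemma convex_support_line j : convex (support_line j).
Proof. exact: convex_hyperplane. Qed.

Lemma support_line_param j p : (j <= n)%N -> support_line j p ->
  exists2 t, p = (1 - t) *: A j + t *: B j &
    t = (p ord0 - lo j) / (hi j - lo j).
Proof.
move=> jn lp; exists ((p ord0 - lo j) / (hi j - lo j)) => //.
have [[_ la] a0] := endA jn; have [[_ lb] b0] := endB jn; have [_ lp1] := lp.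
have /ltr0_neq0 hl : lo j - hi j < 0 by rewrite subr_lt0 lo_lt_hi.
have hl' : hi j - lo j != 0 by rewrite -opprB oppr_eq0.
move: la lb lp1; rewrite /= !dot_line a0 b0 => la lb lp1.
apply: planar_ext; rewrite combE ?a0 ?b0; first by field.
have -> : A j ord_max = c j + lam j * lo j by rewrite -la subrK.
have -> : B j ord_max = c j + lam j * hi j by rewrite -lb subrK.
have -> : p ord_max = c j + lam j * p ord0 by rewrite -lp1 subrK.
by field.
Qed.

Lemma support_line_conv j : (j <= n)%N -> support_line j = conv [set A j; B j].
Proof.
move=> jn; apply/seteqP; split; last first.
  by apply: conv2_sub (@convex_support_line j) _ _; [case: (endA jn)|case: (endB jn)].
move=> p lp; have [t pE tE] := support_line_param jn lp.
have /andP[lo_p p_hi] := rangeL jn lp.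
have hl : 0 < hi j - lo j by rewrite subr_gt0 lo_lt_hi.
rewrite pE; apply: conv2_mem; first by rewrite tE divr_ge0 ?(ltW hl) // subr_ge0.
by rewrite tE ler_pdivrMr // mul1r lerD2r.
Qed.

Lemma edge_support_line j : (j <= n)%N ->
  edge Q (support_line j) /\ support_line j `<=` upper_boundary Q.
Proof.
move=> jn; split; first split.
- by exists (Defs.point (- lam j) 1), (c j); split=> // p; exact: below.
- exists (A j), (B j); split; last by rewrite support_line_conv.
  have [_ a0] := endA jn; have [_ b0] := endB jn.
  by move=> eqAB; have := lo_lt_hi jn; rewrite -a0 -b0 eqAB ltxx.
move=> p [Qp lp]; exists (p ord0), (p ord_max); rewrite -pointE; split=> // eps eps0.
move=> /(below jn); move: lp; rewrite /= !dot_line point0 point1 => <-.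
by rewrite addrAC gerDl leNgt eps0.
Qed.

(** The least [j] with [s <= hi j] works: if it is positive, its predecessor fails, and [hi] of the
    predecessor is [lo j]. *)
Lemma cover_range (s : R) : lo 0%N <= s <= hi n ->
  exists2 j, (j <= n)%N & lo j <= s <= hi j.
Proof.
move=> /andP[lo_s s_hi].
have ex : exists j, s <= hi j by exists n.
case: (ex_minnP ex) => j s_hij minj; exists j; first exact: minj.
rewrite s_hij andbT; case: j s_hij minj => // j _ minj.
rewrite -hi_lo; last by apply: minj.
by rewrite leNgt; apply/negP => /ltW/minj; rewrite ltnn.
Qed.

(** The midpoint of the edge lies on some line [j], which forces the endpoints onto that line.
    Conversely, this midpoint is interior to the segment from [A j] to [B j], which forces that
    segment into the edge. *)
Lemma upper_edge_support_line e : edge Q e -> e `<=` upper_boundary Q ->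
  exists2 j, (j <= n)%N & e = support_line j.
Proof.
move=> [[v [beta [v_le eE]]] [a [b [ab e_ab]]]] up.
pose p : R^[R, 'I_2] := (1 - 2^-1) *: a + 2^-1 *: b.
have half0 : 0 < 2^-1 :> R by rewrite invr_gt0.
have half1 : 2^-1 <= 1 :> R by rewrite invf_le1 ?ler1n.
have ep : e p by rewrite e_ab; exact: conv2_mem (ltW half0) half1.
have ea : e a by rewrite e_ab; apply: conv_mem; left.
have eb : e b by rewrite e_ab; apply: conv_mem; right.
have eQ q : e q -> Q q /\ dot v q = beta by rewrite eE => -[].
have [Qa va] := eQ a ea; have [Qb vb] := eQ b eb; have [Qp vp] := eQ p ep.
have [j jn /andP[lo_p p_hi]] := cover_range (rangeQ Qp).
exists j => //.
have [lA A0] := endA jn; have [lB B0] := endB jn.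
have hl : 0 < hi j - lo j by rewrite subr_gt0 lo_lt_hi.
pose t := (p ord0 - lo j) / (hi j - lo j).
have t0 : 0 <= t by rewrite divr_ge0 ?(ltW hl) // subr_ge0.
have t1 : t <= 1 by rewrite ler_pdivrMr // mul1r lerD2r.
pose q : R^[R, 'I_2] := (1 - t) *: A j + t *: B j.
have lq : support_line j q by exact: (convex_support_line lA lB t0 t1).
have q0 : q ord0 = p ord0.
  rewrite /q combE A0 B0 /t; field; exact: lt0r_neq0.
(* [q] is the point of line [j] with the abscissa of [p]. It lies in [Q], so [p] is not below it,
   and the line bounds [Q], so [p] is not above it. *)
have pq : p = q.
  apply: planar_ext; first by rewrite q0.
  have [s [s' [pE _ noup]]] := up p ep.
  have {pE} [sE s'E] : s = p ord0 /\ s' = p ord_max by rewrite pE point0 point1.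
  subst s s'; have [Qq lq1] := lq.
  apply/eqP; rewrite eq_le; apply/andP; split.
    have := below jn Qp; move: lq1; rewrite /= !dot_line q0 => <-.
    by rewrite lerD2r.
  rewrite leNgt; apply/negP => lt_pq; apply: (noup (q ord_max - p ord_max)).
    by rewrite subr_gt0.
  by rewrite addrC subrK -q0 -pointE.
have lp : support_line j p by rewrite pq.
have [la lb] : support_line j a /\ support_line j b.
  have := below jn Qa; have := below jn Qb; have [_] := lp.
  rewrite /= /p dotDr !dotZr => lp1 leb lea.
  have [ma mb] := midpoint_max lea leb lp1.
  by split; split=> //=; apply: le_anti; rewrite ?lea ?leb.
(* The line is not vertical, so the distinct points [a] and [b] differ in abscissa and their
   midpoint lies strictly between [lo j] and [hi j]. *)
have ab0 : a ord0 != b ord0.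
  apply/eqP => ab0; apply: ab; apply: planar_ext => //.
  have [_] := la; have [_] := lb; rewrite /= !dot_line ab0 => <-.
  by move=> /(congr1 (+%R^~ (lam j * b ord0))); rewrite !subrK.
have [p_gt_lo p_lt_hi] : lo j < p ord0 /\ p ord0 < hi j.
  by rewrite /p combE; apply: midpoint_strict ab0 _ _; apply: rangeL.
have t_gt0 : 0 < t by rewrite divr_gt0 // subr_gt0.
have t_lt1 : t < 1 by rewrite ltr_pdivrMr // mul1r ltrD2r.
have [QA _] := lA; have [QB _] := lB.
(* The functional [v] of the edge attains its bound at [p], a proper convex combination of [A j] and
   [B j], hence at both of them. *)
have [eA eB] : e (A j) /\ e (B j).
  have := v_le _ QA; have := v_le _ QB; move: vp; rewrite pq /q dotDr !dotZr => vq leB leA.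
  have hA : 0 <= (1 - t) * (beta - dot v (A j)).
    by rewrite mulr_ge0 ?subr_ge0 // ltW.
  have hB : 0 <= t * (beta - dot v (B j)) by rewrite mulr_ge0 ?subr_ge0 // ltW.
  have hAB : (1 - t) * (beta - dot v (A j)) + t * (beta - dot v (B j)) = 0.
    by rewrite -[X in _ = X](subrr beta) -[in X in _ = _ - X]vq; ring.
  have /andP[/eqP eA /eqP eB] :
      ((1 - t) * (beta - dot v (A j)) == 0) && (t * (beta - dot v (B j)) == 0).
    by rewrite -paddr_eq0 // hAB.
  rewrite eE; split; split=> //=; apply/esym/eqP; rewrite -subr_eq0.
    by move/eqP: eA; rewrite mulf_eq0 [1 - t == 0]subr_eq0 (gt_eqF t_lt1).
  by move/eqP: eB; rewrite mulf_eq0 (gt_eqF t_gt0).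
apply/seteqP; split.
  by rewrite e_ab; apply: conv2_sub la lb; exact: convex_support_line.
rewrite support_line_conv //; apply: conv2_sub eA eB.
by rewrite eE; exact: convex_hyperplane.
Qed.

Lemma hi_le_lo i j : (i < j <= n)%N -> hi i <= lo j.
Proof.
elim: j => // j IHj; rewrite ltnS => /andP[]; rewrite leq_eqVlt => /orP[/eqP->|ij] jn.
  by rewrite hi_lo.
rewrite -hi_lo //; apply: le_trans (IHj _) (ltW (lo_lt_hi (ltnW jn))).
by rewrite ij ltnW.
Qed.

Lemma upper_edges_support_lines : upper_edges Q (mkseq support_line n.+1).
Proof.
split=> [e|i j]; rewrite size_mkseq.
  split=> [[j jn ->]|[edge_e up]].
    by rewrite nth_mkseq //; exact: edge_support_line.
  by have [j jn ->] := upper_edge_support_line edge_e up; exists j; rewrite ?nth_mkseq.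
move=> /andP[ij jn] p q; rewrite !nth_mkseq //; last exact: ltn_trans ij jn.
have i_n : (i <= n)%N by exact: leq_trans (ltnW ij) jn.
move=> /(rangeL i_n)/andP[_ p_hi] /(rangeL jn)/andP[lo_q _].
apply: le_trans p_hi (le_trans _ lo_q); apply: hi_le_lo.
by rewrite ij.
Qed.

End Planar.

(** * Cellular strings of the rank-selected polytope *)

Section MatroidPolytope.
Variables (R : realType) (E : finType) (M : matroid E) (k : seq nat).
Implicit Types (I J : {set E}) (F : set R^[R, E]) (u w x y : R^[R, E]).
Local Notation P := (rank_selected_polytope R M k).
Local Notation ones := (all_ones R E).
Local Notation S := (selected M k).
Local Notation vtx := (indicator R).

Lemma dot_indicator u I : dot u (vtx I) = weight u I.
Proof.
rewrite /weight big_mkcond; apply: eq_bigr => e _.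
by rewrite ffunE; case: (e \in I); rewrite ?mulr1 ?mulr0.
Qed.

Lemma dot_ones_indicator I : dot ones (vtx I) = #|I|%:R.
Proof.
rewrite dot_indicator /weight -sum1_card natr_sum.
by apply: eq_bigr => e _; rewrite ffunE.
Qed.

Lemma vertex_mem I : I \in S -> P (vtx I).
Proof. by move=> /selectedP[iI cI]; apply: conv_mem; exists I. Qed.

Lemma polytope_face_dot u w (b b' : R) x : (forall x, P x -> dot u x <= b) ->
    (forall I, I \in S -> dot u (vtx I) = b -> dot w (vtx I) = b') ->
  P x -> dot u x = b -> dot w x = b'.
Proof.
move=> ub uw; apply: conv_face_dot => [a Aa|_ [I [iI cI ->]]]; first exact/ub/conv_mem.
by apply: uw; apply/selectedP.
Qed.

Lemma polytope_face_extreme u w (b : R) x : (forall x, P x -> dot u x <= b) ->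
    P x -> dot u x = b ->
  exists I, [/\ I \in S, dot u (vtx I) = b & dot w x <= dot w (vtx I)].
Proof.
move=> ub Px uxb.
have [a Aa|_ [[I [iI cI ->]] uI le_wx]] := conv_face_extreme w _ Px uxb.
  exact/ub/conv_mem.
by exists I; split=> //; apply/selectedP.
Qed.

(** [u] and [b] cut out the face, while [I] and [J] are vertices of least and greatest size, which
    locate its two end faces. *)
Definition face_witness F u (b : R) I J :=
  [/\ forall x, P x -> dot u x <= b, F = P `&` [set x | dot u x = b],
      I \in S /\ J \in S, F (vtx I) /\ F (vtx J)
    & (#|I| < #|J|)%N /\
      forall x, F x -> #|I|%:R <= dot ones x <= #|J|%:R].

(** On a face, [ones] and [- ones] are largest at vertices, so the smallest and largest vertex sets
    bound the height. Were their sizes equal, [ones] would be constant. *)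
Lemma face_witness_exists F : face P F -> nonconstant ones F ->
  exists u b I J, face_witness F u b I J.
Proof.
move=> [u [b [ub FE]]] [x [y [Fx Fy xy]]]; exists u, b.
have F_vtx I : I \in S -> dot u (vtx I) = b -> F (vtx I).
  by move=> SI uI; rewrite FE; split=> //; exact: vertex_mem.
have extreme w z : F z ->
    exists I, [/\ I \in S, F (vtx I) & dot w z <= dot w (vtx I)].
  rewrite {1}FE => -[Pz uz]; have [I [SI uI le_wz]] := polytope_face_extreme w ub Pz uz.
  by exists I; split=> //; exact: F_vtx.
pose VF := [pred I | (I \in S) && `[< F (vtx I) >]].
have [I0 [SI0 FI0 _]] := extreme ones x Fx.
have VF0 : VF I0 by rewrite /= SI0; apply/asboolP.
have [I /andP[SI /asboolP FI] minI] := arg_minnP (fun I : {set E} => #|I|) VF0.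
have [J /andP[SJ /asboolP FJ] maxJ] := arg_maxnP (fun I : {set E} => #|I|) VF0.
have bounds z : F z -> #|I|%:R <= dot ones z <= #|J|%:R.
  move=> Fz; apply/andP; split.
    have [I' [SI' FI']] := extreme (- ones) z Fz.
    rewrite !dotNl lerN2 dot_ones_indicator; apply: le_trans.
    by rewrite ler_nat; apply: minI; rewrite /= SI'; apply/asboolP.
  have [J' [SJ' FJ']] := extreme ones z Fz.
  rewrite dot_ones_indicator => /le_trans; apply.
  by rewrite ler_nat; apply: maxJ; rewrite /= SJ'; apply/asboolP.
exists I, J; split=> //; split=> //.
rewrite ltnNge; apply/negP => le_JI; apply: xy.
have const z : F z -> dot ones z = #|J|%:R.
  move=> /bounds/andP[Iz zJ]; apply: le_anti; rewrite zJ.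
  by apply: le_trans Iz; rewrite ler_nat.
by rewrite !const.
Qed.

(** The bound [b] is attained at the selected vertex [I], so it is the maximal [u]-weight of a
    selected set. *)
Lemma face_argmax F u b I J K : face_witness F u b I J ->
  K \in argmax S (weight u) <-> K \in S /\ F (vtx K).
Proof.
move=> [ub -> [SI _] [[_ uI] _] _]; split=> [/argmaxP[SK maxK]|[SK [_ uK]]].
  split=> //; split; first exact: vertex_mem.
  apply: le_anti; rewrite ub; last exact: vertex_mem.
  by rewrite -uI /= !dot_indicator maxK.
apply/argmaxP; split=> // L SL; rewrite -!dot_indicator uK.
by apply: ub; apply: vertex_mem.
Qed.

Lemma face_max F u b I J K : face_witness F u b I J -> K \in S ->
  max_face ones F (vtx K) <-> F (vtx K) /\ #|K| = #|J|.
Proof.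
move=> [_ _ _ [_ FJ] [_ bnd]] SK; split=> [[FK maxK]|[FK cK]]; split=> //.
  have := maxK _ FJ; have /andP[_] := bnd _ FK; rewrite !dot_ones_indicator !ler_nat.
  by move=> h1 h2; apply/eqP; rewrite eqn_leq h1.
by move=> y /bnd/andP[_]; rewrite dot_ones_indicator cK.
Qed.

Lemma face_min F u b I J K : face_witness F u b I J -> K \in S ->
  max_face (- ones) F (vtx K) <-> F (vtx K) /\ #|K| = #|I|.
Proof.
move=> [_ _ _ [FI _] [_ bnd]] SK; split=> [[FK minK]|[FK cK]]; split=> //.
  have := minK _ FI; rewrite !dotNl lerN2.
  have /andP[+ _] := bnd _ FK; rewrite !dot_ones_indicator !ler_nat.
  by move=> h1 h2; apply/eqP; rewrite eqn_leq h1 h2.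
by move=> y /bnd/andP[+ _]; rewrite !dotNl lerN2 dot_ones_indicator cK.
Qed.

Lemma proj_convex w : convex (proj ones w @` P).
Proof.
move=> _ _ t [x Px <-] [y Py <-] t0 t1.
exists ((1 - t) *: x + t *: y); first exact: conv_convex.
by apply: planar_ext; rewrite combE /proj ?point0 ?point1 dotDr !dotZr.
Qed.

(** This matches lines of slope [l] in the projection with tilts of the weight by [l]. *)
Lemma dot_proj w (l : R) x :
  dot (Defs.point (- l) 1) (proj ones w x) = dot (w - l *: ones) x.
Proof. by rewrite dot_line /proj point0 point1 dotDl dotNl dotZl. Qed.

(** The faces are translated into families of selected sets of maximal weight, the chain of tilts
    supplies a single weight, and its supporting lines are then identified with the faces. *)
Lemma cellular_coherent Fs : cellular_string ones P Fs -> coherent ones P Fs.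
Proof.
move=> [sz faces minF maxF link].
have [n szE] : exists n, size Fs = n.+1 by exists (size Fs).-1; rewrite prednK.
rewrite szE /= in faces minF maxF link; set F := nth set0 Fs in faces minF maxF link.
have /choice[d dP] j : exists d : R^[R, E] * R * {set E} * {set E}, (j <= n)%N ->
    face_witness (F j) d.1.1.1 d.1.1.2 d.1.2 d.2.
  (* Indices beyond [n] receive placeholder data. *)
  have [jn|_] := leqP j n; last by exists (0, 0, finset.set0, finset.set0).
  have [/face_witness_exists H /H[u [b [I [J FIJ]]]]] := faces j jn.
  by exists (u, b, I, J).
pose u j := (d j).1.1.1; pose b j := (d j).1.1.2.
pose I j := (d j).1.2; pose J j := (d j).2.
have {}dP j : (j <= n)%N -> face_witness (F j) (u j) (b j) (I j) (J j) := dP j.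
(* The upper end of one face is the lower end of the next, so the two faces have the same vertices
   at their common level. *)
have linkP j K : (j < n)%N -> K \in S ->
    F j (vtx K) /\ #|K| = #|J j| <-> F j.+1 (vtx K) /\ #|K| = #|I j.+1|.
  move=> jn SK; rewrite -(face_max (dP j (ltnW jn)) SK) -(face_min (dP j.+1 jn) SK).
  by have [-> ->] := link j jn.
have SIJ j : (j <= n)%N -> I j \in S /\ J j \in S by case/dP.
have FIJ j : (j <= n)%N -> F j (vtx (I j)) /\ F j (vtx (J j)) by case/dP.
have argF j K : (j <= n)%N -> K \in argmax S (weight (u j)) <-> K \in S /\ F j (vtx K).
  by move=> jn; exact: face_argmax (dP j jn).
have hilo j : (j < n)%N -> #|J j| = #|I j.+1|.
  move=> jn; have [_ SJ] := SIJ j (ltnW jn); have [_ FJ] := FIJ j (ltnW jn).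
  by have [/(_ (conj FJ erefl))[]] := linkP j _ jn SJ.
have [j jn|j jn|w [lam [_ lamE]]] :=
    @argmax_chain R E M k n (fun j => u j : E -> R) (fun j => #|I j|) (fun j => #|J j|).
- have [_ _ [SI SJ] [FI FJ] [ltIJ bnd]] := dP j jn; split=> //.
  + move=> K /(argF j K jn)[SK FK].
    by have /andP[] := bnd _ FK; rewrite dot_ones_indicator !ler_nat => -> ->.
  + by exists (I j) => //; apply/(argF j _ jn).
  by exists (J j) => //; apply/(argF j _ jn).
- split=> [|K cK]; first exact: hilo.
  apply/idP/idP.
    move=> /(argF j K (ltnW jn))[SK FK]; apply/(argF j.+1 K jn); split=> //.
    by have [/(_ (conj FK cK))[]] := linkP j K jn SK.
  move=> /(argF j.+1 K jn)[SK FK]; apply/(argF j K (ltnW jn)); split=> //.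
  by have [_ /(_ (conj FK (etrans cK (hilo j jn))))[]] := linkP j K jn SK.
pose wv : R^[R, E] := [ffun e => w e].
(* At vertices [z j] takes the tilt by [lam j] as its value, and [c j] is its maximum, attained at
   [I j]. *)
pose z j := wv - lam j *: ones.
pose c j := dot (z j) (vtx (I j)).
have z_tilt j K : dot (z j) (vtx K) = tilt w (lam j) K.
  rewrite dotDl dotNl dotZl dot_ones_indicator dot_indicator; congr (_ - _).
  by apply: eq_bigr => e _; rewrite ffunE.
have z_le j x : (j <= n)%N -> P x -> dot (z j) x <= c j.
  move=> jn; apply: conv_le => _ [K [iK cK ->]]; rewrite /c !z_tilt.
  have [SI _] := SIJ j jn; have [FI _] := FIJ j jn.
  have : I j \in argmax S (weight (u j)) by apply/(argF j _ jn).
  by rewrite -lamE // => /argmaxP[_]; apply; apply/selectedP.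
have z_vtx j K : (j <= n)%N -> K \in S ->
    dot (z j) (vtx K) = c j <-> dot (u j) (vtx K) = b j.
  move=> jn SK; have [_ FE _ _ _] := dP j jn.
  have [SI _] := SIJ j jn; have [FI _] := FIJ j jn.
  have oI : I j \in argmax S (tilt w (lam j)) by rewrite lamE //; apply/(argF j _ jn).
  have -> : dot (z j) (vtx K) = c j <-> F j (vtx K).
    rewrite /c !z_tilt; split=> [eqK|FK].
      have : K \in argmax S (tilt w (lam j)) by apply: argmax_mem oI SK _; rewrite eqK.
      by rewrite lamE // => /(argF j K jn)[].
    by apply: argmax_eqval oI; rewrite lamE //; apply/(argF j K jn).
  by rewrite FE; split=> [[]//|uK]; split=> //; exact: vertex_mem.
(* [z j] and [u j] attain their maxima at the same vertices, so they cut out the same face. *)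
have FE j : (j <= n)%N -> F j = P `&` [set x | dot (z j) x = c j].
  move=> jn; have [ub -> _ _ _] := dP j jn; apply/seteqP; split=> x [Px] /= ux; split=> //=.
    by apply: polytope_face_dot ub _ Px ux => K SK; apply z_vtx.
  have zb y : P y -> dot (z j) y <= c j by exact: z_le.
  by apply: polytope_face_dot zb _ Px ux => K SK; apply z_vtx.
pose Q := proj ones wv @` P.
have lineP j x : P x -> support_line Q lam c j (proj ones wv x) <-> dot (z j) x = c j.
  move=> Px; rewrite /support_line /setI /= dot_proj; split=> [[]//|zx]; split=> //.
  by exists x.
exists wv, (mkseq (support_line Q lam c) n.+1).
  apply: (@upper_edges_support_lines _ _ _ lam c (fun j => #|I j|%:R) (fun j => #|J j|%:R)
    (fun j => proj ones wv (vtx (I j))) (fun j => proj ones wv (vtx (J j)))).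
  - exact: proj_convex.
  - by move=> j _ jn [x Px <-]; rewrite dot_proj z_le.
  - by move=> j jn; have [_ _ _ _ [ltIJ _]] := dP j jn; rewrite ltr_nat.
  - by move=> j jn; rewrite hilo.
  (* The first face reaches the bottom of the polytope and the last face its top, so the intervals
     of sizes span the whole width. *)
  - move=> _ [x Px <-]; rewrite /proj point0.
    have [SI _] := SIJ 0%N (leq0n n); have [_ SJ] := SIJ n (leqnn n).
    have [FI _] := FIJ 0%N (leq0n n); have [_ FJ] := FIJ n (leqnn n).
    have [_ /(_ (conj FI erefl))/minF[_ /(_ x Px)]] := face_min (dP 0%N (leq0n n)) SI.
    rewrite !dotNl lerN2 !dot_ones_indicator => ->.
    have [_ /(_ (conj FJ erefl))/maxF[_ /(_ x Px)]] := face_max (dP n (leqnn n)) SJ.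
    by rewrite dot_ones_indicator.
  - move=> j p jn lp; have [[x Px xp] _] := lp; move: lp; rewrite -xp => /(lineP j x Px) zx.
    have [_ _ _ _ [_ bnd]] := dP j jn; rewrite /proj point0; apply: bnd.
    by rewrite FE.
  - move=> j jn; have [SI _] := SIJ j jn; split; last by rewrite /proj point0 dot_ones_indicator.
    by apply/(lineP j _ (vertex_mem SI)).
  move=> j jn; have [_ SJ] := SIJ j jn; split; last by rewrite /proj point0 dot_ones_indicator.
  apply/(lineP j _ (vertex_mem SJ)); have [_] := FIJ j jn; rewrite FE //.
  by case.
apply: (@eq_from_nth _ set0); rewrite ?size_map ?size_iota // szE => j jn.
rewrite (nth_map set0) ?size_mkseq // nth_mkseq // -/(F j) FE //.
by apply/seteqP; split=> x [Px] /= /(lineP j x Px) H; split=> //; apply/lineP.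
Qed.

End MatroidPolytope.

Theorem theorem5p2 (R : realType) (E : finType) (M : matroid E)
    (s : nat) (k : s.-tuple nat)
    (hs : (2 <= s)%N)
    (hk : sorted ltn k)
    (hkr : forall i : 'I_s, (tnth k i <= rank M)%N)
    (Fs : seq (set R^[R, E])) :
  cellular_string (all_ones R E) (rank_selected_polytope R M k) Fs ->
  coherent (all_ones R E) (rank_selected_polytope R M k) Fs.
Proof. exact: cellular_coherent. Qed.
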